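(* Let $m,n,p,q\in\mathbb{N}$, let $x_1,\dots,x_p\in\mathbb{C}[\mathbb{S}_m\times\mathbb{S}_n^{\mathrm{op}}]^{\oplus q}$ and let $R(m,n)$ be the $\mathbb{S}_m\times\mathbb{S}_n^{\mathrm{op}}$-submodule of $\mathbb{C}[\mathbb{S}_m\times\mathbb{S}_n^{\mathrm{op}}]^{\oplus q}$ generated by $x_1,\dots,x_p$. For $1\le i\le p$ write $x_i=(x_i^{(1)},\dots,x_i^{(q)})$ for the decomposition of $x_i$ along the direct sum. Let $\lambda\vdash m$, $\mu\vdash n$ be partitions and write $$\varphi_{\lambda,\mu}(x_i^{(j)})=\sum_{k=1}^{N_{i,j}^{\lambda,\mu}}A_{i,j}^{(k)}\otimes B_{i,j}^{(k)}\in\mathcal{M}_{d_\lambda}(\mathbb{C})\otimes\mathcal{M}_{d_\mu}(\mathbb{C}).$$ Then $$m_{\lambda,\mu}(R(m,n))=\operatorname{rk}\left(\left(\sum_{k=1}^{N_{i,j}^{\lambda,\mu}}A_{i,j}^{(k)}\odot B_{i,j}^{(k)}\right)_{\substack{1\le i\le p\\1\le j\le q}}\right),$$ the rank of the block matrix with $p\times q$ blocks of size $d_\lambda d_\mu\times d_\lambda d_\mu$.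
   Context: $\mathbb{S}_n$ is the symmetric group. For a partition $\lambda\vdash m$, $V_\lambda$ is the corresponding irreducible complex representation of $\mathbb{S}_m$ and $d_\lambda$ its dimension. For $\mu\vdash n$, $V_\mu^{\mathrm{op}}$ is the corresponding irreducible right $\mathbb{S}_n$-module (left $\mathbb{S}_n^{\mathrm{op}}$-module). $V_\lambda\boxtimes V_\mu^{\mathrm{op}}$ is the irreducible $\mathbb{S}_m\times\mathbb{S}_n^{\mathrm{op}}$-representation on $V_\lambda\otimes V_\mu^{\mathrm{op}}$, and $m_{\lambda,\mu}(V)$ is its multiplicity in a representation $V$ of $\mathbb{S}_m\times\mathbb{S}_n^{\mathrm{op}}$. $\mathcal{M}_d(\mathbb{C})$ is the algebra of $d\times d$ matrices. $\varphi:\mathbb{C}[\mathbb{S}_m\times\mathbb{S}_n^{\mathrm{op}}]\to\bigoplus_{\lambda\vdash m,\,\mu\vdash n}\mathcal{M}_{d_\lambda}(\mathbb{C})\otimes\mathcal{M}_{d_\mu}(\mathbb{C})$ is the isomorphism of algebras given by the composite $\mathbb{C}[\mathbb{S}_m\times\mathbb{S}_n^{\mathrm{op}}]\cong\mathbb{C}[\mathbb{S}_m]\otimes\mathbb{C}[\mathbb{S}_n]\cong\left(\bigoplus_{\lambda\vdash m}\mathcal{M}_{d_\lambda}(\mathbb{C})\right)\otimes\left(\bigoplus_{\mu\vdash n}\mathcal{M}_{d_\mu}(\mathbb{C})\right)$ (using $\mathbb{C}[\mathbb{S}_n^{\mathrm{op}}]\cong\mathbb{C}[\mathbb{S}_n]$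 and the Wedderburn isomorphisms of the group algebras, the factor indexed by $\lambda$ corresponding to $V_\lambda$ and the one indexed by $\mu$ to $V_\mu^{\mathrm{op}}$). $\varphi_{\lambda,\mu}$ is the composite of $\varphi$ with the projection onto $\mathcal{M}_{d_\lambda}(\mathbb{C})\otimes\mathcal{M}_{d_\mu}(\mathbb{C})$. For $A\in\mathcal{M}_r(\mathbb{C})$, $B\in\mathcal{M}_s(\mathbb{C})$, the Kronecker product is the block matrix $A\odot B=(A_{ij}B)_{1\le i,j\le r}\in\mathcal{M}_{rs}(\mathbb{C})$. *)

(* Defs.v *)
From HB Require Import structures.
From mathcomp Require Import all_boot all_order all_algebra all_fingroup.
From mathcomp Require Import all_solvable all_field all_character.
From mathcomp Require Import boolp classical_sets reals.
From mathcomp Require Import complex mxtens.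

Set Implicit Arguments.
Unset Strict Implicit.
Unset Printing Implicit Defensive.

Import GRing.Theory.
Local Open Scope ring_scope.

Definition opposite_group (gT : finGroupType) : Type := gT.

Section OppositeGroup.
Variable gT : finGroupType.
Local Notation gop := (opposite_group gT).

HB.instance Definition _ := Finite.on gop.

Definition opg_mul (x y : gop) : gop := ((y : gT) * (x : gT))%g.
Definition opg_one : gop := (1 : gT)%g.
Definition opg_inv (x : gop) : gop := ((x : gT)^-1)%g.

Fact opg_mulA : associative opg_mul.
Proof. by move=> x y z; rewrite /opg_mul mulgA. Qed.
Fact opg_mul1g : left_id opg_one opg_mul.
Proof. by move=> x; rewrite /opg_mul mulg1. Qed.
Fact opg_mulVg : left_inverse opg_one opg_inv opg_mul.
Proof. by move=> x; rewrite /opg_mul mulgV. Qed.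

HB.instance Definition _ :=
  Finite_isGroup.Build gop opg_mulA opg_mul1g opg_mulVg.

Definition unop (x : gop) : gT := x.

End OppositeGroup.

Section LeftRepresentations.
Variables (F : fieldType) (gT : finGroupType).

Record lrep := LRep {
  lrep_space :> vectType F;
  lrep_act : gT -> 'End(lrep_space);
  lrep_act1 : lrep_act 1%g = \1%VF;
  lrep_actM : forall g h,
    lrep_act (g * h)%g = (lrep_act g \o lrep_act h)%VF
}.

Definition stable (V : lrep) (U : {vspace V}) : Prop :=
  forall g, (lrep_act V g @: U <= U)%VS.

Definition simple_submodule (V : lrep) (U : {vspace V}) : Prop :=
  [/\ stable U, U != 0%VS &
      forall W : {vspace V}, stable W -> (W <= U)%VS -> W = 0%VS \/ W = U].

Definition irreducible_lrep (V : lrep) : Prop :=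
  simple_submodule (fullv : {vspace V}).

Definition isomorphic_to_submodule (S V : lrep) (U : {vspace V}) : Prop :=
  exists f : 'Hom(S, V),
    [/\ lker f = 0%VS, limg f = U &
        forall g v, f (lrep_act S g v) = lrep_act V g (f v)].

Definition generated_submodule (V : lrep) p (x : 'I_p -> V) : {vspace V} :=
  (\sum_(i < p) \sum_(g : gT) <[lrep_act V g (x i)]>)%VS.

Definition has_multiplicity (S V : lrep) (U : {vspace V}) (k : nat) : Prop :=
  exists (r : nat) (W : 'I_r -> {vspace V}) (I : {set 'I_r}),
    [/\ directv (\sum_i W i), (\sum_i W i)%VS = U,
        forall i, simple_submodule (W i),
        forall i, (i \in I) <-> isomorphic_to_submodule S (W i) &
        #|I| = k].

(* By Jordan-Hoelder at most one k satisfies [has_multiplicity S U k], and by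
   Maschke one exists if U is stable and #|gT| is invertible in F; the default
   value 0 is then never used. *)
Definition multiplicity (S V : lrep) (U : {vspace V}) : nat :=
  xget 0%N [set k | has_multiplicity S U k]%classic.

End LeftRepresentations.

Section RegularModule.
Variables (F : fieldType) (gT : finGroupType).

(* The group algebra F[gT], \sum_g a g * g being represented by the function a.
   Only its left gT-module structure is needed. *)
Definition group_alg : vectType F := {ffun gT -> F^o}.

Definition group_alg_elt (g : gT) : group_alg := [ffun h => (h == g)%:R].

Definition regular_fun (g : gT) (a : group_alg) : group_alg :=
  [ffun h => a (g^-1 * h)%g].

Fact regular_fun_linear g : linear (regular_fun g).
Proof. by move=> c a b; apply/ffunP=> h; rewrite !ffunE. Qed.
HB.instance Definition _ g :=
  GRing.isLinear.Build F group_alg group_alg _ (regular_fun g)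
    (regular_fun_linear g).

Fact regular_act1 : linfun (regular_fun 1%g) = \1%VF.
Proof.
by apply/lfunP=> a; rewrite !lfunE; apply/ffunP=> h; rewrite ffunE invg1 mul1g.
Qed.
Fact regular_actM g h :
  linfun (regular_fun (g * h)%g) =
  (linfun (regular_fun g) \o linfun (regular_fun h))%VF.
Proof.
apply/lfunP=> a; rewrite comp_lfunE !lfunE; apply/ffunP=> k.
by rewrite !ffunE invMg mulgA.
Qed.
Definition regular_lrep : lrep F gT := LRep regular_act1 regular_actM.

Fact regular_lrepE g h :
  lrep_act regular_lrep g (group_alg_elt h) = group_alg_elt (g * h)%g.
Proof.
by rewrite lfunE; apply/ffunP=> k; rewrite !ffunE (can2_eq (mulKVg _) (mulKg _)).
Qed.

End RegularModule.

Section PowerModule.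
Variables (F : fieldType) (gT : finGroupType) (V : lrep F gT) (q : nat).

Definition power_fun (g : gT) (v : {ffun 'I_q -> V}) : {ffun 'I_q -> V} :=
  [ffun j => lrep_act V g (v j)].

Fact power_fun_linear g : linear (power_fun g).
Proof. by move=> c u v; apply/ffunP=> j; rewrite !ffunE linearP. Qed.
HB.instance Definition _ g :=
  GRing.isLinear.Build F {ffun 'I_q -> V} {ffun 'I_q -> V} _ (power_fun g)
    (power_fun_linear g).

Fact power_act1 : linfun (power_fun 1%g) = \1%VF.
Proof.
apply/lfunP=> v; rewrite !lfunE; apply/ffunP=> j.
by rewrite ffunE lrep_act1 lfunE.
Qed.
Fact power_actM g h :
  linfun (power_fun (g * h)%g) =
  (linfun (power_fun g) \o linfun (power_fun h))%VF.
Proof.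
apply/lfunP=> v; rewrite comp_lfunE !lfunE; apply/ffunP=> j.
by rewrite !ffunE lrep_actM comp_lfunE.
Qed.
Definition power_lrep : lrep F gT := LRep power_act1 power_actM.

End PowerModule.

(* A matrix representation acts on the left on COLUMN vectors, contrary to the
   row-vector convention of mxrepresentation. *)
Section ColumnModule.
Variables (F : fieldType) (gT : finGroupType) (d : nat).
Variable rho : mx_representation F [set: gT] d.

Definition column_fun (g : gT) (v : 'cV[F]_d) : 'cV[F]_d := rho g *m v.

Fact column_fun_linear g : linear (column_fun g).
Proof. by move=> c u v; rewrite /column_fun linearP. Qed.
HB.instance Definition _ g :=
  GRing.isLinear.Build F 'cV[F]_d 'cV[F]_d _ (column_fun g)
    (column_fun_linear g).

Fact column_act1 : linfun (column_fun 1%g) = \1%VF.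
Proof. by apply/lfunP=> v; rewrite !lfunE /= /column_fun repr_mx1 mul1mx. Qed.
Fact column_actM g h :
  linfun (column_fun (g * h)%g) =
  (linfun (column_fun g) \o linfun (column_fun h))%VF.
Proof.
apply/lfunP=> v; rewrite comp_lfunE !lfunE /= /column_fun.
by rewrite repr_mxM ?inE // mulmxA.
Qed.
Definition column_lrep : lrep F gT := LRep column_act1 column_actM.

(* The right gT-module with v . h = h^-1 v, as a left module over
   opposite_group gT. *)
Definition op_mx (h : opposite_group gT) : 'M[F]_d := rho (unop h)^-1%g.
Fact op_mx_repr : mx_repr [set: opposite_group gT] op_mx.
Proof.
split=> [|g h _ _]; first by rewrite /op_mx /unop invg1 repr_mx1.
by rewrite /op_mx -repr_mxM ?inE // -invMg.
Qed.
Definition op_representation := MxRepresentation op_mx_repr.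

End ColumnModule.

(* External tensor product of 'cV_r and 'cV_s: the space 'cV_r (x) 'cV_s is
   modelled by 'M_(r, s), with u (x) w := u *m w^T. *)
Section BoxProduct.
Variables (F : fieldType) (gT1 gT2 : finGroupType) (r s : nat).
Variables (rho : mx_representation F [set: gT1] r).
Variables (sigma : mx_representation F [set: gT2] s).

Definition box_fun (g : gT1 * gT2) (M : 'M[F]_(r, s)) : 'M[F]_(r, s) :=
  rho g.1 *m M *m (sigma g.2)^T.

Fact box_fun_tensor g (u : 'cV[F]_r) (w : 'cV[F]_s) :
  box_fun g (u *m w^T) = (rho g.1 *m u) *m (sigma g.2 *m w)^T.
Proof. by rewrite /box_fun trmx_mul !mulmxA. Qed.

Fact box_fun_linear g : linear (box_fun g).
Proof.
by move=> c M N; rewrite /box_fun mulmxDr mulmxDl -scalemxAr -scalemxAl.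
Qed.
HB.instance Definition _ g :=
  GRing.isLinear.Build F 'M[F]_(r, s) 'M[F]_(r, s) _ (box_fun g)
    (box_fun_linear g).

Fact box_act1 : linfun (box_fun 1%g) = \1%VF.
Proof.
apply/lfunP=> M; rewrite !lfunE /= /box_fun.
by rewrite !repr_mx1 trmx1 mul1mx mulmx1.
Qed.
Fact box_actM g h :
  linfun (box_fun (g * h)%g) =
  (linfun (box_fun g) \o linfun (box_fun h))%VF.
Proof.
apply/lfunP=> M; rewrite comp_lfunE !lfunE /= /box_fun.
by rewrite !repr_mxM ?inE // trmx_mul !mulmxA.
Qed.
Definition box_lrep : lrep F (gT1 * gT2)%type := LRep box_act1 box_actM.

End BoxProduct.

(* 'M_r (x) 'M_s is modelled by 'M_(r * r, s * s) through the outer product of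
   the vectors of entries: the entry of tensor A B at (mxvec_index i j,
   mxvec_index k l) is A i j * B k l. *)
Definition tensor (F : fieldType) (r s : nat) (A : 'M[F]_r) (B : 'M[F]_s) :
  'M[F]_(r * r, s * s) := (mxvec A)^T *m mxvec B.

(* The component 'M_r (x) 'M_s of the Wedderburn isomorphism of
   F[gT1 * opposite_group gT2], for irreducible matrix representations rho and
   sigma of gT1 and gT2; F[opposite_group gT2] is identified with F[gT2] by
   h |-> h^-1. *)
Definition wedderburn_component (F : fieldType) (gT1 gT2 : finGroupType)
    (r s : nat) (rho : mx_representation F [set: gT1] r)
    (sigma : mx_representation F [set: gT2] s)
    (a : group_alg F (gT1 * opposite_group gT2)%type) : 'M[F]_(r * r, s * s) :=
  \sum_(g : gT1 * opposite_group gT2)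
    a g *: tensor (rho g.1) (op_representation sigma g.2).

Record intpart (m : nat) := IntPart {
  intpart_seq :> seq nat;
  intpartP : [&& sorted geq intpart_seq, 0%N \notin intpart_seq
               & sumn intpart_seq == m]
}.

(* The boxes of the Young diagram are numbered 0, ..., m - 1 row by row; box i
   is in row [reshape_index la i] and column [reshape_offset la i]. *)
Section Specht.
Variables (F : fieldType) (m : nat) (la : intpart m).

Definition row_group : {set 'S_m} :=
  [set s : 'S_m | [forall i, reshape_index la (s i) == reshape_index la i]].
Definition column_group : {set 'S_m} :=
  [set s : 'S_m | [forall i, reshape_offset la (s i) == reshape_offset la i]].

(* Permutations compose from left to right in perm.v. The isomorphism s |-> s^-1
   with 'S_m under the usual composition preserves the row and column groups
   and signs, hence it carries the usual Specht module to the one below. *)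
Definition young_symmetrizer : regular_lrep F 'S_m :=
  \sum_(s in row_group) \sum_(t in column_group)
    (-1) ^+ odd_perm t *: group_alg_elt F (s * t)%g.

Definition specht_module : {vspace regular_lrep F 'S_m} :=
  generated_submodule (fun _ : 'I_1 => young_symmetrizer).

(* rho is the irreducible representation attached to la, written in a basis. *)
Definition affords_irrep d (rho : mx_representation F [set: 'S_m] d) : Prop :=
  irreducible_lrep (column_lrep rho) /\
  isomorphic_to_submodule (column_lrep rho) specht_module.

End Specht.

(* Main.v *)
(* Put G = S_m x S_n^op and let T be the box product. A tuple t in T^q is the
   same as a G-morphism f_t : C[G]^q -> T, and in coordinates the values
   f_t(x_i) are the blocks of the block matrix applied to t; hence the kernel
   of that matrix consists of the t with f_t = 0 on R(m,n). Write R(m,n) as a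
   direct sum of simple submodules W_i. By Schur's lemma f_t vanishes on the
   W_i not isomorphic to T and is given by a scalar a_i(t) on the others, so
   the kernel is the common kernel of the functionals a_i. They are linearly
   independent because projections onto the W_i extend to G-morphisms on C[G]^q
   by averaging. So the rank of the matrix is the number of the a_i, which is
   the multiplicity. *)
Require Import Defs.
From HB Require Import structures.
From mathcomp Require Import all_boot all_order all_algebra all_fingroup.
From mathcomp Require Import all_solvable all_field all_character.
From mathcomp Require Import boolp classical_sets reals.
From mathcomp Require Import complex mxtens.

Set Implicit Arguments.
Unset Strict Implicit.
Unset Printing Implicit Defensive.

Import GRing.Theory.
Local Open Scope ring_scope.

(* [stable] is shadowed by the MathComp libraries. *)
Local Notation stable := Defs.stable.

(** * Equivariant maps and generated submodules *)

Section Equivariance.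
Variables (F : fieldType) (gT : finGroupType).
Implicit Types V S : lrep F gT.

(** Relative to [U] because a linear projection onto a submodule commutes with the action only there
    in general; averaging then gives a morphism on all of [V]. *)
Definition equivariant_on V (W : lrep F gT) (U : {vspace V})
    (f : 'Hom(V, W)) : Prop :=
  forall g v, v \in U -> f (lrep_act V g v) = lrep_act W g (f v).

Lemma lrep_actK V g : cancel (lrep_act V g) (lrep_act V g^-1%g).
Proof. by move=> v; rewrite -comp_lfunE -lrep_actM mulVg lrep_act1 lfunE. Qed.

Lemma stable_act V (U : {vspace V}) g v :
  stable U -> v \in U -> lrep_act V g v \in U.
Proof. by move=> stU Uv; apply: (subvP (stU g)); apply: memv_img. Qed.

Lemma stableP V (U : {vspace V}) :
  (forall g v, v \in U -> lrep_act V g v \in U) -> stable U.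
Proof. by move=> stU g; apply/subvP=> _ /memv_imgP[v Uv ->]; apply: stU. Qed.

Lemma stable_ker V (W : lrep F gT) (U : {vspace V}) (f : 'Hom(V, W)) :
  stable U -> equivariant_on U f -> stable (U :&: lker f)%VS.
Proof.
move=> stU eqf; apply: stableP => g v; rewrite !memv_cap !memv_ker.
by case/andP=> Uv /eqP fv0; rewrite stable_act //= eqf // fv0 linear0.
Qed.

Lemma stable_img V (W : lrep F gT) (U : {vspace V}) (f : 'Hom(V, W)) :
  stable U -> equivariant_on U f -> stable (f @: U)%VS.
Proof.
move=> stU eqf; apply: stableP => g _ /memv_imgP[v Uv ->].
by rewrite -eqf // memv_img // stable_act.
Qed.

Lemma generated_submodule_act V p (x : 'I_p -> V) i g :
  lrep_act V g (x i) \in generated_submodule x.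
Proof.
rewrite memvE /generated_submodule.
by rewrite (sumv_sup i) // (sumv_sup g).
Qed.

Lemma generated_submodule_sub V p (x : 'I_p -> V) (U : {vspace V}) :
  stable U -> (forall i, x i \in U) -> (generated_submodule x <= U)%VS.
Proof.
move=> stU Ux; apply/subv_sumP=> i _; apply/subv_sumP=> g _.
by rewrite -memvE stable_act.
Qed.

Lemma generated_submodule_stable V p (x : 'I_p -> V) :
  stable (generated_submodule x).
Proof.
move=> h; rewrite limg_sum; apply/subv_sumP=> i _.
rewrite limg_sum; apply/subv_sumP=> g _.
by rewrite limg_line -memvE -comp_lfunE -lrep_actM generated_submodule_act.
Qed.

(** * Averaging over the group and complete reducibility *)

Definition average V (W : lrep F gT) (f : 'Hom(V, W)) : 'Hom(V, W) :=
  ((#|gT|%:R)^-1 *: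
    \sum_(g : gT) (lrep_act W g^-1%g \o (f \o lrep_act V g))%VF)%R.

Lemma averageE V (W : lrep F gT) (f : 'Hom(V, W)) v :
  average f v =
  (#|gT|%:R)^-1 *: \sum_(g : gT) lrep_act W g^-1%g (f (lrep_act V g v)).
Proof.
rewrite scale_lfunE sum_lfunE; congr (_ *: _).
by apply: eq_bigr => g _; rewrite !comp_lfunE.
Qed.

Lemma average_equivariant V (W : lrep F gT) (f : 'Hom(V, W)) :
  equivariant_on fullv (average f).
Proof.
move=> h v _; rewrite !averageE [RHS]linearZ /=; congr (_ *: _).
rewrite linear_sum.
(* After replacing g by g h^-1, the term is (g h^-1)^-1 f(g h^-1 h v) = h g^-1 f(g v). *)
rewrite (reindex_inj (mulIg h^-1%g)) /=; apply: eq_bigr => g _.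
rewrite -(comp_lfunE (lrep_act V _)) -lrep_actM mulgKV invMg invgK.
by rewrite lrep_actM comp_lfunE.
Qed.

(** Every summand equals f v. Thus [average f] extends the restriction of f to [U] to a morphism on
    the whole module. *)
Lemma average_id V (W : lrep F gT) (U : {vspace V}) (f : 'Hom(V, W)) v :
    #|gT|%:R != 0 :> F -> equivariant_on U f -> v \in U ->
  average f v = f v.
Proof.
move=> nzG eqf Uv; rewrite averageE.
rewrite (eq_bigr (fun=> f v)) => [|g _]; last by rewrite eqf // lrep_actK.
by rewrite sumr_const -scaler_nat scalerA mulVf // scale1r.
Qed.

Lemma average_in V (W : lrep F gT) (f : 'Hom(V, W)) (U : {vspace W}) v :
  stable U -> (forall u, f u \in U) -> average f v \in U.
Proof.
move=> stU Uf; rewrite averageE memvZ // memv_suml // => g _.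
exact: stable_act.
Qed.

(* Maschke: the complement is the kernel of an averaged projection. *)
Lemma stable_complement V (U W : {vspace V}) :
    #|gT|%:R != 0 :> F -> stable U -> stable W -> (W <= U)%VS ->
  exists C : {vspace V},
    [/\ stable C, (W + C)%VS = U & (W :&: C = 0)%VS].
Proof.
move=> nzG stU stW sWU; pose f := average (projv W).
have f_id v : v \in W -> f v = v.
  move=> Wv; rewrite /f (@average_id _ _ W) ?projv_id // => g u Wu.
  by rewrite !projv_id // stable_act.
have Wf v : f v \in W by apply: average_in => // u; apply: memv_proj.
exists (U :&: lker f)%VS; split.
- apply: stable_ker => // g v _; apply: average_equivariant; exact: memvf.
- apply/subv_anti/andP; split; first by rewrite subv_add sWU capvSl.
  apply/subvP=> u Uu; rewrite -[u](subrK (f u)) addrC memv_add //.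
  have Ufu : f u \in U by apply: (subvP sWU).
  by rewrite memv_cap memvB //= memv_ker linearB /= (f_id (f u)) // subrr.
apply/eqP; rewrite -subv0; apply/subvP=> v.
rewrite !memv_cap memv_ker memv0 => /and3P[Wv _ /eqP fv].
by rewrite -(f_id v Wv) fv.
Qed.

(** A nonzero stable subspace of [U] of least dimension is simple. *)
Lemma simple_submodule_exists V (U : {vspace V}) :
  stable U -> U != 0%VS ->
  exists W : {vspace V}, simple_submodule W /\ (W <= U)%VS.
Proof.
move=> stU nzU.
pose P (W : {vspace V}) := [/\ stable W, W != 0%VS & (W <= U)%VS].
pose Pn n := `[< exists W, P W /\ \dim W = n >].
have exP : exists n, Pn n by exists (\dim U); apply/asboolP; exists U.
case: (ex_minnP exP) => n /asboolP[W [[stW nzW sWU] dimW]] minW.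
exists W; split=> //; split=> // W' stW' sW'W.
have [->|nzW'] := eqVneq W' 0%VS; [by left | right].
apply/eqP; rewrite eqEdim sW'W dimW minW //; apply/asboolP.
by exists W'; split=> //; split=> //; apply: subv_trans sWU.
Qed.

(** Induction on the dimension: split off a simple submodule and apply the hypothesis to a stable
    complement. *)
Lemma semisimple V (U : {vspace V}) :
    #|gT|%:R != 0 :> F -> stable U ->
  exists r (W : 'I_r -> {vspace V}),
    [/\ directv (\sum_i W i), (\sum_i W i)%VS = U
      & forall i, simple_submodule (W i)].
Proof.
move=> nzG; have [n] := ubnP (\dim U); elim: n U => // n IHn U ltUn stU.
have [->|nzU] := eqVneq U 0%VS.
  exists 0, (fun=> 0%VS); split; last by case.
    by apply/directvP; rewrite /= !big_ord0 dimv0.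
  by rewrite big_ord0.
have [W0 [simW0 sW0U]] := simple_submodule_exists stU nzU.
have [stW0 nzW0 _] := simW0.
have [U' [stU' defU dxU]] := stable_complement nzG stU stW0 sW0U.
have dimU : \dim U = (\dim W0 + \dim U')%N.
  by rewrite -defU dimv_disjoint_sum.
have [|r [W [dxW defU' simW]]] := IHn U' _ stU'.
  rewrite -ltnS (leq_trans _ ltUn) // dimU ltnS -add1n leq_add2r.
  by rewrite lt0n dimv_eq0.
exists r.+1, (fun i => if unlift ord0 i is Some j then W j else W0).
have sumW : (\sum_(i < r.+1)
    (if unlift ord0 i is Some j then W j else W0) = U)%VS.
  rewrite big_ord_recl unlift_none -defU; congr (_ + _)%VS.
  by rewrite -defU'; apply: eq_bigr => i _; rewrite liftK.
split=> //; last by move=> i; case: unliftP.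
apply/directvP; rewrite /= sumW big_ord_recl unlift_none dimU; congr addn.
rewrite -defU' (directvP dxW) /=; apply: eq_bigr => i _.
by rewrite liftK.
Qed.

(** * Multiplicities and Schur's lemma *)

Lemma has_multiplicity_exists S V (U : {vspace V}) :
    #|gT|%:R != 0 :> F -> stable U ->
  exists k, has_multiplicity S U k.
Proof.
move=> nzG stU; have [r [W [dxW defU simW]]] := semisimple nzG stU.
pose I := [set i | `[< isomorphic_to_submodule S (W i) >]].
exists #|I|, r, W, I; split=> // i; rewrite inE.
by split=> /asboolP.
Qed.

(** [multiplicity] picks one admissible number, and complete reducibility guarantees that there is
    one. So it suffices to show that every admissible number equals k. *)
Lemma multiplicity_eq S V (U : {vspace V}) k :
    #|gT|%:R != 0 :> F -> stable U ->
    (forall k', has_multiplicity S U k' -> k' = k) ->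
  multiplicity S U = k.
Proof.
move=> nzG stU uniq_k; apply: uniq_k.
exact: xgetPex (has_multiplicity_exists _ nzG stU).
Qed.

Definition absolutely_simple S : Prop :=
  irreducible_lrep S /\
  forall f : 'End(S),
    equivariant_on fullv f -> exists a, forall s, f s = a *: s.

(** If f is nonzero on [W], simplicity of [W] makes it injective there and simplicity of [S] makes
    it onto; its inverse is then an isomorphism from [S] to [W]. *)
Lemma schur S V (W : {vspace V}) (f : 'Hom(V, S)) :
    irreducible_lrep S -> simple_submodule W -> equivariant_on W f ->
    ~ isomorphic_to_submodule S W ->
  {in W, forall w, f w = 0}.
Proof.
move=> [_ nzS simS] [stW nzW simW] eqf noniso w Ww; apply/eqP.
apply/negPn/negP=> nzfw; case: noniso.
have [kerf|kerf] := simW _ (stable_ker stW eqf) (capvSl _ _); last first.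
  case/negP: nzfw; rewrite -memv_ker.
  by move: Ww; rewrite -{1}kerf => /memv_capP[].
have [img0|imgf] := simS _ (stable_img stW eqf) (subvf _).
  by case/negP: nzfw; rewrite -memv0 -img0 memv_img.
have injf u v : u \in W -> v \in W -> f u = f v -> u = v.
  move=> Wu Wv fuv; apply/eqP; rewrite -subr_eq0 -memv0 -kerf memv_cap.
  by rewrite memvB //= memv_ker linearB /= fuv subrr.
(* [f1^-1] is a section of [f1]. Projecting its values to [W] keeps their images under [f1], so [h]
   inverts f with values in [W]. *)
pose f1 := (f \o projv W)%VF; pose h := (projv W \o f1^-1)%VF.
have Wh s : h s \in W by rewrite comp_lfunE memv_proj.
have fh s : f (h s) = s.
  rewrite !comp_lfunE -(comp_lfunE f) limg_lfunVK //.
  by rewrite limg_comp limg_proj imgf memvf.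
exists h; split.
- by apply/eqP/lker0P=> s s' hs; rewrite -(fh s) hs fh.
- apply/subv_anti/andP; split; first by apply/subvP=> _ /memv_imgP[s _ ->].
  apply/subvP=> v Wv; rewrite -[v](injf (h (f v))) ?fh //.
  by rewrite memv_img ?memvf.
- by move=> g s; apply: injf; rewrite ?stable_act // fh eqf // fh.
Qed.

End Equivariance.

(** * Rank as a number of independent functionals *)

Section LinearAlgebra.
Variable F : fieldType.

(** The matrix [C] with the functionals as columns has the same left kernel as [A], hence the same
    rank. The dual vectors [u] form a left inverse of [C], so this rank is the number of columns of
    [C]. *)
Lemma mxrank_functionals n l (A : 'M[F]_(n, l)) (I : finType)
    (c : I -> 'rV[F]_n -> F) (u : I -> 'rV[F]_n) :
    (forall i, scalar (c i)) ->
    (forall v, v *m A = 0 <-> forall i, c i v = 0) ->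
    (forall i j, c i (u j) = (i == j)%:R) ->
  \rank A = #|I|.
Proof.
move=> c_lin kerA c_u.
pose C := \matrix_(a < n, i < #|I|) c (enum_val i) (delta_mx 0 a).
have mulC v i : (v *m C) 0 i = c (enum_val i) v.
  pose cL : {scalar 'rV[F]_n} := HB.pack (c (enum_val i))
    (GRing.isLinear.Build _ _ _ _ (c (enum_val i)) (c_lin _)).
  rewrite mxE -[RHS]/(cL v) [in RHS](row_sum_delta v) linear_sum.
  by apply: eq_bigr => a _; rewrite linearZ mxE.
have kerC (v : 'rV_n) : (v *m A == 0) = (v *m C == 0).
  apply/eqP/eqP=> [vA0|vC0].
    have c0 := (kerA v).1 vA0; by apply/rowP=> i; rewrite mulC c0 mxE.
  by apply: (kerA v).2 => i; rewrite -(enum_rankK i) -(mulC v) vC0 mxE.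
have rankAC : \rank A = \rank C.
  have eqker : (kermx A :=: kermx C)%MS.
    apply/eqmxP/rV_eqP => v; rewrite !(sameP sub_kermxP eqP).
    exact: kerC.
  have:= congr1 (subn n) eqker.1.
  by rewrite !mxrank_ker !subKn ?rank_leq_row.
rewrite rankAC; apply/eqP/row_fullP.
exists (\matrix_i u (enum_val i)); apply/row_matrixP=> i.
rewrite row_mul rowK; apply/rowP=> j.
by rewrite mulC c_u !mxE (inj_eq enum_val_inj) eq_sym.
Qed.

Lemma sumv_pi_unique (V : vectType F) (I : finType) (W : I -> {vspace V})
    (U : {vspace V}) (defU : U = (\sum_i W i)%VS) (w : I -> V) i :
    directv (\sum_i W i) -> (forall j, w j \in W j) ->
  sumv_pi_for defU i (\sum_j w j) = w i.
Proof.
move=> dxW Ww; have Usum : \sum_j w j \in U.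
  by rewrite defU memv_sumr.
have /directv_sum_unique uniqW := dxW.
have /eqP := sumv_pi_sum defU Usum.
rewrite uniqW => [/forallP/(_ i)/eqP //|j _|j _]; last exact: Ww.
exact: memv_sum_pi.
Qed.

End LinearAlgebra.

(** * Morphisms out of the free module, and rank as multiplicity *)

Section FreeModule.
Variables (F : fieldType) (gT : finGroupType) (q : nat).
Local Notation P := (power_lrep (regular_lrep F gT) q).

Lemma power_regular_actE g (v : P) j h :
  (lrep_act P g v : {ffun 'I_q -> group_alg F gT}) j h = v j (g^-1 * h)%g.
Proof. by rewrite lfunE /= ffunE lfunE ffunE. Qed.

(** The morphism that sends the j-th basis vector of the free module to [t j]. *)
Definition free_hom_fun (S : lrep F gT) (t : 'I_q -> S) (v : P) : S :=
  \sum_j \sum_(g : gT) v j g *: lrep_act S g (t j).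

Fact free_hom_linear (S : lrep F gT) (t : 'I_q -> S) :
  linear (free_hom_fun t).
Proof.
move=> a u v; rewrite /free_hom_fun scaler_sumr -big_split /=.
apply: eq_bigr => j _; rewrite scaler_sumr -big_split /=.
by apply: eq_bigr => g _; rewrite !ffunE scalerDl scalerA.
Qed.
HB.instance Definition _ (S : lrep F gT) (t : 'I_q -> S) :=
  GRing.isLinear.Build F P S _ (free_hom_fun t) (free_hom_linear t).

Definition free_hom (S : lrep F gT) (t : 'I_q -> S) : 'Hom(P, S) :=
  linfun (free_hom_fun t).

Lemma free_homE (S : lrep F gT) (t : 'I_q -> S) v :
  free_hom t v = \sum_j \sum_(g : gT) v j g *: lrep_act S g (t j).
Proof. exact: lfunE. Qed.

Lemma free_hom_equivariant (S : lrep F gT) (t : 'I_q -> S) :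
  equivariant_on fullv (free_hom t).
Proof.
move=> h v _; rewrite !free_homE [RHS]linear_sum; apply: eq_bigr => j _.
rewrite [RHS]linear_sum (reindex_inj (mulgI h)) /=; apply: eq_bigr => g _.
by rewrite power_regular_actE mulKg [RHS]linearZ lrep_actM comp_lfunE.
Qed.

Definition free_basis (j : 'I_q) : P :=
  [ffun k => if k == j then group_alg_elt F (1%g : gT) else 0].

Lemma free_basis_actE g j k h :
  (lrep_act P g (free_basis j) : {ffun 'I_q -> group_alg F gT}) k h =
  ((k == j) && (h == g))%:R.
Proof.
rewrite power_regular_actE ffunE; case: (k == j); rewrite ffunE //=.
by rewrite (can2_eq (mulKVg _) (mulKg _)) mulg1.
Qed.

Lemma free_decomposition (v : P) :
  v = \sum_j \sum_(g : gT) v j g *: lrep_act P g (free_basis j).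
Proof.
(* Only the coordinates of the translated basis vectors matter, so the vectors are generalized to a
   family [D] with these coordinates. *)
have := free_basis_actE; move: (fun g j => lrep_act P g (free_basis j)) => D DE.
apply/ffunP=> k; apply/ffunP=> h; rewrite sum_ffunE sum_ffunE.
rewrite (bigD1 k) //= [X in _ + X]big1 ?addr0 => [|j /negPf neq_jk].
  rewrite sum_ffunE sum_ffunE (bigD1 h) //= big1 ?addr0 => [|g /negPf neq_gh].
    by rewrite ffunE ffunE DE !eqxx [RHS]mulr1.
  by rewrite ffunE ffunE DE eqxx eq_sym neq_gh [LHS]mulr0.
rewrite sum_ffunE sum_ffunE big1 // => g _.
by rewrite ffunE ffunE DE eq_sym neq_jk [LHS]mulr0.
Qed.

Lemma free_hom_linear_in (S : lrep F gT) a (t t1 t2 : 'I_q -> S) v :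
    (forall j, t j = a *: t1 j + t2 j) ->
  free_hom t v = a *: free_hom t1 v + free_hom t2 v.
Proof.
move=> tE; rewrite !free_homE scaler_sumr -big_split; apply: eq_bigr => j _ /=.
rewrite scaler_sumr -big_split; apply: eq_bigr => g _ /=.
by rewrite tE linearP scalerDr !scalerA mulrC.
Qed.

Lemma eq_free_hom (S : lrep F gT) (t t' : 'I_q -> S) :
  t =1 t' -> free_hom t = free_hom t'.
Proof. by move=> /funext->. Qed.

(** The translates of the basis vectors span the free module, so an equivariant map is determined by
    its values on the basis. *)
Lemma free_homP (S : lrep F gT) (f : 'Hom(P, S)) :
  equivariant_on fullv f -> f = free_hom (fun j => f (free_basis j)).
Proof.
move=> eqf; apply/lfunP=> v; rewrite [in LHS](free_decomposition v) free_homE.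
rewrite linear_sum; apply: eq_bigr => j _.
rewrite linear_sum; apply: eq_bigr => g _.
by rewrite linearZ /= eqf ?memvf.
Qed.

(** Row vectors [u] stand for the tuples [t u]. For i in [I], composing the morphism of [t u] with
    an isomorphism [phi i] from [S] to [W i] gives a scalar depending linearly on [u]; these scalars
    are the functionals fed to [mxrank_functionals]. *)
Lemma rank_has_multiplicity (S : lrep F gT) (U : {vspace P}) k n l
    (A : 'M[F]_(n, l)) (t : 'rV[F]_n -> 'I_q -> S) :
    #|gT|%:R != 0 :> F -> absolutely_simple S -> stable U ->
    (forall j, linear (t^~ j)) ->
    (forall s, exists u, t u =1 s) ->
    (forall u, u *m A = 0 <-> {in U, forall v, free_hom (t u) v = 0}) ->
    has_multiplicity S U k ->
  \rank A = k.
Proof.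
move=> nzG [irrS endS] stU t_lin t_surj kerA.
move=> [r [W [I [dxW defU simW isoI cardI]]]].
(* Outside [I] the map is a dummy 0. *)
have /choice [phi phiP] : forall i, exists f : 'Hom(S, P), i \in I ->
    [/\ lker f = 0%VS, limg f = W i & equivariant_on fullv f].
  move=> i; have [iI|] := boolP (i \in I); last by exists 0.
  have [f [kerf imf eqf]] := (isoI i).1 iI; by exists f => _; split.
(* The functional [ell] takes the value 1 at the nonzero vector [s0], so it recovers a from a *:
   s0. *)
pose s0 : S := vpick fullv.
have nzs0 : s0 != 0 by rewrite vpick0; case: irrS.
pose ell : S -> F := coord [tuple s0] ord0.
have ell0 : ell s0 = 1.
  rewrite /ell -[X in coord _ _ X]/([tuple s0]`_(ord0 : 'I_1)).
  by rewrite coord_free // seq1_free.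
have stW i : stable (W i) by case: (simW i).
have WU i : (W i <= U)%VS by rewrite -defU (sumv_sup i).
pose J := {i | i \in I}.
pose c (i : J) u := ell (free_hom (t u) (phi (val i) s0)).
have phiW i s : i \in I -> phi i s \in W i.
  by move=> /phiP[_ <- _]; rewrite memv_img ?memvf.
rewrite -cardI -(card_sig (mem I)).
have c_surj i0 : exists u, forall i : J, c i u = (i == i0)%:R.
  have [ker0 im0 eq0] := phiP _ (valP i0).
  have /eqP/lker0_lfunK phiK := ker0.
  (* Project [U] onto the summand [i0] and identify it with [S]. This is equivariant on [U]; its
     average is a morphism of the free module that agrees with it on [U], and is therefore given by
     some tuple [t u]. *)
  pose h := ((phi (val i0))^-1 \o sumv_pi_for (esym defU) (val i0))%VF.
  have hE ws : (forall i, ws i \in W i) ->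
      h (\sum_i ws i) = (phi (val i0))^-1%VF (ws (val i0)).
    by move=> Wws; rewrite comp_lfunE sumv_pi_unique.
  have eqh : equivariant_on U h.
    move=> g v; rewrite -defU => /memv_sumP[ws Wws ->].
    have {}Wws i : ws i \in W i by apply: Wws.
    rewrite linear_sum /= !hE // => [|i]; last exact: stable_act.
    have := Wws (val i0); rewrite -im0 => /memv_imgP[s _ ->].
    by rewrite -eq0 ?memvf // !phiK.
  have [u tu] := t_surj (fun j => average h (free_basis j)).
  exists u => i; rewrite /c (eq_free_hom tu) -free_homP; last first.
    exact: average_equivariant.
  have Wis0 := phiW _ s0 (valP i).
  rewrite (average_id nzG eqh) ?(subvP (WU (val i))) //.
  (* The only nonzero component of this vector is the one at [val i], so [h] takes it to [s0] if i =
     i0 and to 0 otherwise. *)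
  pose ws i' := if i' == val i then phi (val i) s0 else 0.
  have -> : phi (val i) s0 = \sum_i' ws i'.
    by rewrite -big_mkcond big_pred1_eq.
  rewrite hE => [|i']; last first.
    by rewrite /ws; case: (eqVneq i' (val i)) => [->|_] //; rewrite mem0v.
  rewrite /ws eq_sym val_eqE; case: (eqVneq i i0) => [->|_].
    by rewrite phiK ell0.
  by rewrite linear0 /ell linear0.
have /choice [u uP] := c_surj.
apply: (@mxrank_functionals _ _ _ _ _ c u).
- move=> i a x y; rewrite /c (@free_hom_linear_in _ a _ (t x) (t y)).
    by rewrite /ell linearP.
  by move=> j; rewrite t_lin.
- move=> v; rewrite kerA; split=> [v0 i|c0 w].
    have Us0 : phi (val i) s0 \in U.
      by apply: (subvP (WU _)); apply: phiW; apply: (valP i).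
    by rewrite /c v0 // /ell linear0.
  rewrite -defU => /memv_sumP[ws Wws ->]; rewrite linear_sum big1 // => i _.
  (* Schur's lemma handles the summands not isomorphic to [S]. On the others the composite with
     [phi i] is a scalar, which [c0] forces to be 0. *)
  have [iI|iI] := boolP (i \in I); last first.
    apply: (schur irrS (simW i)); last exact: Wws.
      by move=> g x _; rewrite free_hom_equivariant ?memvf.
    by move=> iso; case/negP: iI; apply/isoI.
  have [_ imphi eqphi] := phiP i iI.
  have [|a fa] := endS (free_hom (t v) \o phi i)%VF.
    move=> g s _; rewrite !comp_lfunE eqphi ?memvf //.
    by rewrite free_hom_equivariant ?memvf.
  have := Wws i isT; rewrite -imphi => /memv_imgP[s _ ->].
  have := c0 (exist _ i iI); rewrite /c /= -comp_lfunE fa.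
  rewrite /ell linearZ /= -/(ell s0) ell0 mulr1 => a0.
  by rewrite -comp_lfunE fa a0 scale0r.
- by move=> i j; apply: uP.
Qed.

End FreeModule.

(** * Irreducibility and spanning of the matrix algebra *)

Definition spanning (F : fieldType) (gT : finGroupType) d
    (rho : mx_representation F [set: gT] d) : Prop :=
  exists a : gT -> 'M[F]_d -> F, forall A, A = \sum_g a g A *: rho g.

(* The column action of rho on v corresponds to the row action of its dual on
   v^T, to which the theory of mxrepresentation applies. *)
Section DualRepresentation.
Variables (F : fieldType) (gT : finGroupType) (d : nat).
Variable rho : mx_representation F [set: gT] d.

Definition dual_mx (g : gT) : 'M[F]_d := (rho g^-1%g)^T.

Fact dual_mx_repr : mx_repr [set: gT] dual_mx.
Proof.
split=> [|g h _ _]; first by rewrite /dual_mx invg1 repr_mx1 trmx1.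
by rewrite /dual_mx invMg repr_mxM ?inE // trmx_mul.
Qed.
Definition dual_representation := MxRepresentation dual_mx_repr.

(** Transposing the row space of a dual submodule [U] gives a stable subspace [W] of columns,
    because [dual_mx g^-1] is [(rho g)^T]. If [W] is zero or everything, so is [U]. *)
Lemma dual_irreducible :
  irreducible_lrep (column_lrep rho) -> mx_irreducible dual_representation.
Proof.
move=> [_ nz simple]; apply/mx_irrP; split.
  case: posnP nz => // d0; case/negP; rewrite -dimv_eq0 dimvf.
  by rewrite /dim /= d0.
move=> U modU nzU.
pose W : {vspace column_lrep rho} := (\sum_i <[(row i U)^T : 'cV_d]>)%VS.
have UW (v : 'cV_d) : (v^T <= U)%MS -> v \in W.
  case/submxP=> D defv; rewrite -[v]trmxK defv mulmx_sum_row linear_sum.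
  by apply: memv_sumr => i _; rewrite linearZ memvZ ?memv_line.
have WU (v : 'cV_d) : v \in W -> (v^T <= U)%MS.
  move=> /memv_sumP[ws Wws ->]; rewrite linear_sum summx_sub // => i _.
  have /vlineP[a ->] := Wws i isT.
  by rewrite linearZ scalemx_sub //= trmxK row_sub.
have [|W0|Wfull] := simple W _ (subvf _).
- apply: stableP => g v Wv; rewrite lfunE /= /column_fun UW // trmx_mul.
  have := mxmoduleP modU g^-1%g (finset.in_setT _).
  rewrite /= /dual_mx invgK; apply: submx_trans.
  by rewrite submxMr // WU.
- case/negP: nzU; apply/eqP/row_matrixP=> i; rewrite row0.
  have : (row i U)^T \in W by rewrite UW // trmxK row_sub.
  by rewrite W0 memv0 => /eqP/(congr1 trmx); rewrite trmxK trmx0.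
- rewrite -sub1mx; apply/rV_subP => v _; rewrite -[v]trmxK WU // Wfull.
  exact: memvf.
Qed.

End DualRepresentation.

(* Burnside's theorem. *)
Lemma irreducible_spanning (F : closedFieldType) (gT : finGroupType) d
    (rho : mx_representation F [set: gT] d) :
  irreducible_lrep (column_lrep rho) -> spanning rho.
Proof.
move=> /dual_irreducible/group_closure_closed_field/mx_abs_irrP[_ [a aE]].
(* Expand A^T in the dual matrices and transpose back: [dual_mx g] becomes [rho g^-1], whence the
   inverted index. *)
exists (fun g A => a g^-1%g A^T) => A.
rewrite -[LHS]trmxK [in LHS](aE A^T) linear_sum (reindex_inj invg_inj) /=.
apply: eq_big => [g|g _]; first by rewrite inE.
by rewrite linearZ /= /dual_mx invgK trmxK.
Qed.

Lemma irreducible_column_gt0 (F : fieldType) (gT : finGroupType) d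
    (rho : mx_representation F [set: gT] d) :
  irreducible_lrep (column_lrep rho) -> (0 < d)%N.
Proof. by move=> /dual_irreducible/mx_irrP[]. Qed.

Lemma op_spanning (F : fieldType) (gT : finGroupType) d
    (rho : mx_representation F [set: gT] d) :
  spanning rho -> spanning (op_representation rho).
Proof.
move=> [a aE]; exists (fun h A => a (unop h)^-1%g A) => A.
by rewrite [LHS]aE (reindex_inj invg_inj).
Qed.

(** Factoring both matrix units through dimension one leaves a 1 x 1 matrix in the middle, namely
    the entry [M i j]. *)
Lemma delta_mul_delta (F : fieldType) m n p q (M : 'M[F]_(n, p))
    (a : 'I_m) (i : 'I_n) (j : 'I_p) (b : 'I_q) :
  delta_mx a i *m M *m delta_mx j b = M i j *: delta_mx a b.
Proof.
rewrite -(mul_delta_mx (0 : 'I_1) a i) -(mul_delta_mx (0 : 'I_1) j b).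
rewrite -!mulmxA (mulmxA M) -colE (mulmxA (delta_mx 0 i)) -rowE.
by rewrite [row _ _]mx11_scalar mul_scalar_mx !mxE -scalemxAr mul_delta_mx.
Qed.

(** * Absolute simplicity of the external tensor product *)

Section BoxModule.
Variables (F : fieldType) (gT1 gT2 : finGroupType) (r s : nat).
Variables (rho : mx_representation F [set: gT1] r).
Variables (sigma : mx_representation F [set: gT2] s).
Hypotheses (span_rho : spanning rho) (span_sigma : spanning sigma).

(** Expanding A and B in the two representations puts two-sided multiplication in the image of the
    group algebra. It therefore preserves stable subspaces and commutes with equivariant
    endomorphisms. *)
Lemma box_two_sided (A : 'M[F]_r) (B : 'M[F]_s) :
  exists c : gT1 * gT2 -> F, forall M : 'M[F]_(r, s),
    A *m M *m B^T = \sum_g c g *: lrep_act (box_lrep rho sigma) g M.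
Proof.
have [a aE] := span_rho; have [b bE] := span_sigma.
exists (fun g => a g.1 A * b g.2 B) => M.
rewrite [in LHS](aE A) [in LHS](bE B) mulmx_suml linear_sum mulmx_suml /=.
under eq_bigr do rewrite mulmx_sumr.
rewrite pair_big /=; apply: eq_bigr => g _.
rewrite lfunE /= /box_fun -scalemxAl linearZ /=.
by rewrite -scalemxAl -scalemxAr scalerA.
Qed.

Lemma box_absolutely_simple :
  (0 < r)%N -> (0 < s)%N -> absolutely_simple (box_lrep rho sigma).
Proof.
move=> r_gt0 s_gt0; pose i0 := Ordinal r_gt0; pose j0 := Ordinal s_gt0.
have nz_delta : delta_mx i0 j0 != 0 :> 'M[F]_(r, s).
  by apply/eqP=> /matrixP/(_ i0 j0)/eqP; rewrite !mxE !eqxx oner_eq0.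
split.
  split.
  - by apply: stableP => g v _; apply: memvf.
  - apply/eqP=> full0; case/negP: nz_delta; rewrite -memv0 -full0.
    exact: memvf.
  move=> U stU _; have [|nzU] := eqVneq U 0%VS; [by left | right].
  (* A nonzero entry of some element of [U] yields every matrix unit by two-sided multiplication and
     rescaling. *)
  have [i [j nzM]] : exists i j, vpick U i j != 0.
    move: nzU; rewrite -vpick0; apply: contraPP => U0; apply/negP/negPn/eqP.
    apply/matrixP=> i j; rewrite mxE; apply/eqP/negPn/negP => Uij.
    by apply: U0; exists i, j.
  apply/subv_anti; rewrite subvf; apply/subvP=> M _.
  rewrite (matrix_sum_delta M) memv_suml // => a _.
  rewrite memv_suml // => b _; rewrite memvZ //.
  have -> : delta_mx a b =
      (vpick U i j)^-1 *: (delta_mx a i *m vpick U *m (delta_mx b j)^T).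
    by rewrite trmx_delta delta_mul_delta scalerA mulVf // scale1r.
  have [c ->] := box_two_sided (delta_mx a i) (delta_mx b j).
  by rewrite memvZ // memv_suml // => g _; rewrite memvZ ?stable_act ?memv_pick.
(* Writing E for matrix units, f(E_ab) = E_(a,i0) f(E_(i0,j0)) E_(j0,b), which is this entry times
   E_ab. *)
move=> f eqf; exists (f (delta_mx i0 j0) i0 j0) => M.
rewrite [in LHS](matrix_sum_delta M) [in RHS](matrix_sum_delta M).
rewrite linear_sum scaler_sumr; apply: eq_bigr => a _.
rewrite linear_sum scaler_sumr; apply: eq_bigr => b _.
rewrite linearZ /= scalerA mulrC -scalerA; congr (_ *: _).
rewrite -delta_mul_delta.
have [c cE] := box_two_sided (delta_mx a i0) (delta_mx b j0).
have -> : delta_mx a b =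
    \sum_g c g *: lrep_act (box_lrep rho sigma) g (delta_mx i0 j0).
  by rewrite -cE trmx_delta !mul_delta_mx.
rewrite -(trmx_delta _ b) cE linear_sum; apply: eq_bigr => g _.
by rewrite linearZ /= eqf ?memvf.
Qed.

End BoxModule.

Lemma card_group_neq0 (F : fieldType) (gT : finGroupType) :
  [pchar F] =i pred0 -> #|gT|%:R != 0 :> F.
Proof.
move=> char0; rewrite (pcharf0P F).1 // -lt0n; apply/card_gt0P.
by exists 1%g.
Qed.

(** * Flattening of matrices and Kronecker products *)

Section Kronecker.
Variables (F : fieldType) (r s : nat).

(** Flattening along [mxtens_index], the indexing used by [*t]. *)
Definition tens_vec (M : 'M[F]_(r, s)) : 'rV[F]_(r * s) :=
  \row_k M (mxtens_unindex k).1 (mxtens_unindex k).2.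

Definition tens_unvec (v : 'rV[F]_(r * s)) : 'M[F]_(r, s) :=
  \matrix_(i, j) v 0 (mxtens_index (i, j)).

Lemma tens_vecK : cancel tens_vec tens_unvec.
Proof. by move=> M; apply/matrixP=> i j; rewrite !mxE mxtens_indexK. Qed.

Lemma tens_unvecK : cancel tens_unvec tens_vec.
Proof.
by move=> v; apply/rowP=> k; rewrite !mxE -surjective_pairing mxtens_unindexK.
Qed.

Fact tens_vec_linear : linear tens_vec.
Proof. by move=> a M N; apply/rowP=> k; rewrite !mxE. Qed.
HB.instance Definition _ :=
  GRing.isLinear.Build F 'M[F]_(r, s) 'rV[F]_(r * s) _ tens_vec tens_vec_linear.

(** The classical identity vec(A M B^T) = (A (x) B) vec(M), transposed for row vectors. *)
Lemma tens_vec_mul (A : 'M[F]_r) (B : 'M[F]_s) M :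
  tens_vec (A *m M *m B^T) = tens_vec M *m (A *t B)^T.
Proof.
apply/rowP=> k; case: (mxtens_indexP k) => i j; rewrite !mxE mxtens_indexK /=.
under eq_bigr do rewrite mxE mulr_suml.
rewrite exchange_big pair_big /=.
rewrite [RHS](reindex (@mxtens_index r s)) /=; last first.
  by exists (@mxtens_unindex r s) => x _;
    rewrite (mxtens_indexK, mxtens_unindexK).
apply: eq_bigr => -[a b] _; rewrite !mxE !mxtens_indexK /=.
by rewrite mulrCA mulrA mulrAC.
Qed.

(* Reindexes the model of 'M_r (x) 'M_s used by [tensor] into Kronecker form. *)
Definition tensor_kronecker (T : 'M[F]_(r * r, s * s)) : 'M[F]_(r * s) :=
  \matrix_(x, y) T (mxvec_index (mxtens_unindex x).1 (mxtens_unindex y).1)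
                   (mxvec_index (mxtens_unindex x).2 (mxtens_unindex y).2).

Fact tensor_kronecker_linear : linear tensor_kronecker.
Proof. by move=> a T U; apply/matrixP=> x y; rewrite !mxE. Qed.
HB.instance Definition _ :=
  GRing.isLinear.Build F 'M[F]_(r * r, s * s) 'M[F]_(r * s) _ tensor_kronecker
    tensor_kronecker_linear.

Lemma tensor_kroneckerE (A : 'M[F]_r) (B : 'M[F]_s) :
  tensor_kronecker (tensor A B) = A *t B.
Proof.
by apply/matrixP=> x y; rewrite !mxE big_ord1 !mxE -/(mxvec _) !mxvecE.
Qed.

End Kronecker.

(** The i-th block of a row vector [u] times the transposed block matrix is the flattened value at
    [x i] of the morphism attached to [u]. Hence the left kernel describes the morphisms vanishing
    on the generated submodule. *)
Lemma rank_box_multiplicity (F : closedFieldType) (gT1 gT2 : finGroupType)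
    (r s p q : nat) (rho : mx_representation F [set: gT1] r)
    (sigma : mx_representation F [set: gT2] s)
    (x : 'I_p -> power_lrep (regular_lrep F (gT1 * gT2)%type) q) :
    [pchar F] =i pred0 ->
    (0 < r)%N -> (0 < s)%N -> spanning rho -> spanning sigma ->
  multiplicity (box_lrep rho sigma) (generated_submodule x) =
  \rank (\mxblock_(i < p, j < q)
    \sum_(g : gT1 * gT2) x i j g *: (rho g.1 *t sigma g.2)).
Proof.
move=> char0 r_gt0 s_gt0 span_rho span_sigma.
have nzG := card_group_neq0 (gT1 * gT2)%type char0.
have stU := generated_submodule_stable x.
(* The transpose is taken because the rank criterion speaks of left kernels. *)
apply: multiplicity_eq => // k multk; apply/esym; rewrite -mxrank_tr.
pose t (u : 'rV[F]_(\sum_(j < q) r * s)) (j : 'I_q) : box_lrep rho sigma :=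
  tens_unvec (submxrow u j).
apply: (rank_has_multiplicity (t := t) nzG _ stU _ _ _ multk).
- exact: box_absolutely_simple.
- by move=> j a u v; apply/matrixP=> i k'; rewrite !mxE.
- move=> w; exists (\mxrow_j tens_vec (w j)) => j.
  by rewrite /t mxrowK tens_vecK.
move=> u.
have vecE i : tens_vec (free_hom (t u) (x i)) = \sum_j submxrow u j *m
    (\sum_(g : gT1 * gT2) x i j g *: (rho g.1 *t sigma g.2))^T.
  rewrite free_homE linear_sum; apply: eq_bigr => j _.
  rewrite !linear_sum /=; apply: eq_bigr => g _.
  rewrite !linearZ /= lfunE /= /box_fun tens_vec_mul.
  by rewrite tens_unvecK.
rewrite -[u in u *m _]submxrowK tr_mxblock mul_mxrow_mxblock.
(* The kernel of a morphism is stable, so vanishing at the generators suffices. *)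
have ker_gen : {in generated_submodule x, forall v, free_hom (t u) v = 0} <->
    forall i, free_hom (t u) (x i) = 0.
  split=> [ker0 i|ker0 v].
    apply: ker0; have := generated_submodule_act x i 1%g.
    by rewrite lrep_act1 lfunE.
  move=> Uv; apply/eqP; rewrite -memv_ker; apply: subvP v Uv.
  apply: generated_submodule_sub => [|i]; last by rewrite memv_ker ker0.
  rewrite -(capfv (lker _)); apply: stable_ker.
    by apply: stableP => g v _; apply: memvf.
  exact: free_hom_equivariant.
rewrite ker_gen; split=> [rows0 i|ker0].
  apply: (can_inj (@tens_vecK _ _ _)); rewrite vecE linear0.
  by have := congr1 (fun v => submxrow v i) rows0; rewrite mxrowK submxrow0.
by apply/mxrowP => i; rewrite mxrowK submxrow0 -vecE ker0 linear0.
Qed.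

Theorem proposition3p16 (R : realType) (m n p q : nat)
    (x : 'I_p -> power_lrep
      (regular_lrep R[i] ('S_m * opposite_group 'S_n)%type) q)
    (la : intpart m) (mu : intpart n) (d_la d_mu : nat)
    (rho : mx_representation R[i] [set: 'S_m] d_la)
    (sigma : mx_representation R[i] [set: 'S_n] d_mu)
    (Hrho : affords_irrep la rho) (Hsigma : affords_irrep mu sigma)
    (N : 'I_p -> 'I_q -> nat)
    (A : 'I_p -> 'I_q -> nat -> 'M[R[i]]_d_la)
    (B : 'I_p -> 'I_q -> nat -> 'M[R[i]]_d_mu)
    (HAB : forall i j,
       wedderburn_component rho sigma (x i j) =
       \sum_(k < N i j) tensor (A i j k) (B i j k)) :
  multiplicity (box_lrep rho (op_representation sigma)) (generated_submodule x)
  = \rank (\mxblock_(i < p, j < q) \sum_(k < N i j) (A i j k *t B i j k)).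
Proof.
case: Hrho Hsigma => [irr_rho _] [irr_sigma _].
rewrite rank_box_multiplicity.
- congr (\rank _); apply/eq_mxblockP => i j.
  (* Linearity of [tensor_kronecker] carries the two expansions of the Wedderburn component, over
     the group and over k, to equal sums of Kronecker products. *)
  have := congr1 (@tensor_kronecker _ _ _) (HAB i j).
  rewrite !linear_sum /= => kronE.
  under [RHS]eq_bigr do rewrite -tensor_kroneckerE.
  rewrite -kronE; apply: eq_bigr => g _.
  by rewrite linearZ /= tensor_kroneckerE.
- exact: Num.Theory.pchar_num.
- exact: irreducible_column_gt0 irr_rho.
- exact: irreducible_column_gt0 irr_sigma.
- exact: irreducible_spanning.
- by apply: op_spanning; apply: irreducible_spanning.
Qed.
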